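(* Let $w\in\mathbb R^n$ be an $L$-generic direction, let $\Lambda\in\mathfrak L^{\mathrm{adm}}_{\beta,w}$ and $I\in\mathcal M_w(\Lambda)$. Then $\sqrt{\mathfrak r_{\Lambda,w,I}}=\mathfrak m$. Consequently, $R_{\Lambda,w,I}=S/\mathfrak r_{\Lambda,w,I}$ is a nonzero finite-dimensional local $\mathbb C$-algebra and a finite-length $S$-module.
   Context: $[n]=\{1,\dots,n\}$. $A=(a_{ij})\in\mathrm{Mat}_{d\times n}(\mathbb Z)$ has rank $d$, $\beta\in\mathbb C^d$, $L=\mathrm{Ker}_{\mathbb Z}(A)$. An exponent lattice is a coset $\Lambda=\lambda+L$ with $\lambda\in\mathbb C^n$, $A\lambda=\beta$; $\mathfrak L_\beta$ is the set of all of them. $\mathrm{nsupp}(\gamma)=\{j\in[n]\mid\gamma_j\in\mathbb Z_{<0}\}$; $\Lambda_I=\{\gamma\in\Lambda\mid\mathrm{nsupp}(\gamma)=I\}$; $\mathrm{NS}(\Lambda)=\{I\subset[n]\mid\Lambda_I\ne\emptyset\}$; $\mathrm{MinNS}(\Lambda)$ is the set of inclusion-minimal elements of $\mathrm{NS}(\Lambda)$. $w$ is $L$-generic if $w\cdot u\ne0$ for all $u\in L\setminus\{0\}$. $\mathcal B_w(\Lambda)$ is the set of $I\in\mathrm{NS}(\Lambda)$ such that $\{w\cdot(\gamma-\lambda)\mid\gamma\in\Lambda_I\}$ is bounded below in $\mathbb R$ (for one, equivalently any, $\lambda\in\Lambda$); $\mathcal U_w(\Lambda)=\mathrm{NS}(\Lambda)\setminus\mathcal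 B_w(\Lambda)$; $\mathcal M_w(\Lambda)=\mathrm{MinNS}(\Lambda)\cap\mathcal B_w(\Lambda)$; $\mathfrak L^{\mathrm{adm}}_{\beta,w}=\{\Lambda\in\mathfrak L_\beta\mid\mathcal M_w(\Lambda)\ne\emptyset\}$. $S=\mathbb C[\partial_{y_1},\dots,\partial_{y_n}]$ (a polynomial ring), $\mathfrak m=\langle\partial_{y_1},\dots,\partial_{y_n}\rangle$, $\partial_y^K=\prod_{j\in K}\partial_{y_j}$. The Euler linear ideal is $\mathfrak e_A=\langle\sum_{j=1}^na_{ij}\partial_{y_j}\mid i=1,\dots,d\rangle$; the boundary ideal at $I$ is $\mathfrak b_{\Lambda,w,I}=\langle\partial_y^{J\setminus I}\mid J\in\mathcal U_w(\Lambda)\rangle$; the local constraint ideal at $I$ is $\mathfrak r_{\Lambda,w,I}=\mathfrak e_A+\mathfrak b_{\Lambda,w,I}$. *)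

(* Defs.v *)
From HB Require Import structures.
From mathcomp Require Import all_boot all_order all_algebra.
From mathcomp Require Import boolp classical_sets reals complex mpoly.

Set Implicit Arguments.
Unset Strict Implicit.
Unset Printing Implicit Defensive.

Import GRing.Theory.

Local Open Scope classical_set_scope.
Local Open Scope ring_scope.
Local Open Scope quotient_scope.

(** * Submodules, ideals, quotient rings *)

Section Modules.
Variables (A : pzRingType) (V : lmodType A).

Definition is_submodule (N : set V) : Prop :=
  [/\ N 0, forall x y, N x -> N y -> N (x + y)
    & forall a x, N x -> N (a *: x)].

(* [l] is the length of a composition series M 0 < M 1 < ... < M l whose
   successive quotients are simple. *)
Definition finite_length : Prop :=
  exists (l : nat) (M : nat -> set V),
    [/\ M 0%N = [set 0], M l = setT
      & forall i, (i < l)%N ->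
        [/\ is_submodule (M i), is_submodule (M i.+1), M i `<` M i.+1
          & forall N, is_submodule N -> M i `<=` N -> N `<=` M i.+1 ->
              N = M i \/ N = M i.+1]].

End Modules.

Definition finite_dimensional (K : fieldType) (V : lmodType K) : Prop :=
  exists (m : nat) (v2r : V -> 'rV[K]_m), linear v2r /\ bijective v2r.

Section Ideals.
Variable A : comPzRingType.

Definition is_ideal (J : set A) : Prop := is_submodule (J : set A^o).

Record ideal := Ideal { ideal_set :> set A; ideal_setP : is_ideal ideal_set }.

Lemma ideal_gen_subproof (G : set A) : is_ideal (smallest is_ideal G).
Proof.
split=> [J [[J0 _ _] _] //|x y xG yG J [JI GJ]|a x xG J [JI GJ]].
  by have [_ JD _] := JI; apply: JD; [apply: xG|apply: yG].
by have [_ _ JM] := JI; apply: JM; apply: xG.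
Qed.

Definition ideal_gen (G : set A) : ideal := Ideal (ideal_gen_subproof G).

Lemma ideal_add_subproof (I J : ideal) :
  is_ideal [set x + y | x in (I : set A) & y in (J : set A)].
Proof.
have [I0 ID IM] := ideal_setP I; have [J0 JD JM] := ideal_setP J; split.
- by exists 0 => //; exists 0; rewrite ?addr0.
- move=> _ _ [x1 Ix1 [y1 Jy1 <-]] [x2 Ix2 [y2 Jy2 <-]].
  exists (x1 + x2); first exact: ID.
  by exists (y1 + y2); [exact: JD|rewrite addrACA].
- move=> a _ [x Ix [y Jy <-]]; exists (a * x); first exact: IM.
  by exists (a * y); [exact: JM|rewrite -mulrDr].
Qed.

Definition ideal_add (I J : ideal) : ideal := Ideal (ideal_add_subproof I J).

Definition radical (J : set A) : set A := [set x | exists k : nat, J (x ^+ k)].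

Definition maximal_ideal (M : set A) : Prop :=
  [/\ is_ideal M, M <> setT
    & forall N, is_ideal N -> M `<=` N -> N <> setT -> N = M].

Definition local_ring : Prop := exists! M : set A, maximal_ideal M.

End Ideals.

(* The library's quotient of a ring by an ideal is restricted to ideals known
   to be proper.  As properness is part of what has to be proved, only the
   quotient of the underlying group is taken from the library, and it is given
   the structure of a possibly zero ring. *)
Section Quotient.
Variables (A : comNzRingType) (J : ideal A).

Definition ideal_pred : {pred A} := fun x => `[< ideal_set J x >].

Lemma ideal_pred_zmod_closed : zmod_closed ideal_pred.
Proof.
have [J0 JD JM] := ideal_setP J; split; first exact/asboolP.
move=> x y /asboolP Jx /asboolP Jy; apply/asboolP.
by apply: JD => //; rewrite -mulN1r; apply: JM.
Qed.

HB.instance Definition _ :=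
  GRing.isZmodClosed.Build A ideal_pred ideal_pred_zmod_closed.

Definition quotient : Type := Quotient.quot ideal_pred.
HB.instance Definition _ := GRing.Zmodule.on quotient.

Definition quotient_pi (x : A) : quotient := \pi_(Quotient.quot ideal_pred) x.
Definition quotient_repr (x : quotient) : A :=
  repr (x : Quotient.quot ideal_pred).

Lemma quotient_reprK : cancel quotient_repr quotient_pi.
Proof. exact: reprK. Qed.

Lemma quotient_piP x y : quotient_pi x = quotient_pi y <-> ideal_set J (x - y).
Proof.
rewrite /quotient_pi; split=> [/eqP|Jxy].
  by rewrite -Quotient.idealrBE => /asboolP.
by apply/eqP; rewrite -Quotient.idealrBE; apply/asboolP.
Qed.

Lemma quotient_piD : {morph quotient_pi : x y / x + y}.
Proof. by move=> x y; rewrite /quotient_pi raddfD. Qed.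

Definition quotient_one : quotient := quotient_pi 1.
Definition quotient_mul (x y : quotient) : quotient :=
  quotient_pi (quotient_repr x * quotient_repr y).

Lemma quotient_mulE x y :
  quotient_mul (quotient_pi x) (quotient_pi y) = quotient_pi (x * y).
Proof.
have [_ JD JM] := ideal_setP J.
have Jr z : ideal_set J (quotient_repr (quotient_pi z) - z).
  by apply/quotient_piP; rewrite quotient_reprK.
apply/quotient_piP; set x' := quotient_repr _; set y' := quotient_repr _.
have -> : x' * y' - x * y = y' * (x' - x) + x * (y' - y).
  by rewrite !mulrBr [y' * x]mulrC [y' * x']mulrC addrA subrK.
by apply: JD; apply: JM; apply: Jr.
Qed.

Fact quotient_mulA : associative quotient_mul.
Proof.
move=> x y z; rewrite -(quotient_reprK x) -(quotient_reprK y).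
by rewrite -(quotient_reprK z) !quotient_mulE mulrA.
Qed.

Fact quotient_mulC : commutative quotient_mul.
Proof. by move=> x y; rewrite /quotient_mul mulrC. Qed.

Fact quotient_mul1 : left_id quotient_one quotient_mul.
Proof. by move=> x; rewrite -(quotient_reprK x) quotient_mulE mul1r. Qed.

Fact quotient_mulD : left_distributive quotient_mul +%R.
Proof.
move=> x y z; rewrite -(quotient_reprK x) -(quotient_reprK y).
by rewrite -(quotient_reprK z) -quotient_piD !quotient_mulE mulrDl quotient_piD.
Qed.

HB.instance Definition _ := GRing.Zmodule_isComPzRing.Build quotient
  quotient_mulA quotient_mulC quotient_mul1 quotient_mulD.

Lemma quotient_piM : {morph quotient_pi : x y / x * y}.
Proof. by move=> x y; rewrite -quotient_mulE. Qed.

Lemma quotient_pi1 : quotient_pi 1 = 1.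
Proof. by []. Qed.

(* A copy of [quotient], carrying its structure of A-module. *)
Definition quotient_module : Type := quotient.
HB.instance Definition _ := GRing.Zmodule.on quotient_module.

Definition quotient_act (a : A) (x : quotient_module) : quotient_module :=
  (quotient_pi a * (x : quotient) : quotient).

Fact quotient_actA a b x :
  quotient_act a (quotient_act b x) = quotient_act (a * b) x.
Proof. by rewrite /quotient_act mulrA -quotient_piM. Qed.

Fact quotient_act1 : left_id 1 quotient_act.
Proof. by move=> x; rewrite /quotient_act quotient_pi1 mul1r. Qed.

Fact quotient_actDr : right_distributive quotient_act +%R.
Proof. by move=> a x y; apply: (@mulrDr quotient). Qed.

Fact quotient_actDl x : {morph quotient_act^~ x : a b / a + b}.
Proof. by move=> a b; rewrite /quotient_act quotient_piD mulrDl. Qed.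

HB.instance Definition _ := GRing.Zmodule_isLmodule.Build A quotient_module
  quotient_actA quotient_act1 quotient_actDr quotient_actDl.

End Quotient.

Section QuotientAlgebra.
Variables (K : pzRingType) (A : comAlgType K) (J : ideal A).

Definition quotient_scale (k : K) (x : quotient J) : quotient J :=
  quotient_pi J k%:A * x.

Fact quotient_scaleA k l x :
  quotient_scale k (quotient_scale l x) = quotient_scale (k * l) x.
Proof.
by rewrite /quotient_scale mulrA -quotient_piM -scalerAl mul1r scalerA.
Qed.

Fact quotient_scale1 : left_id 1 quotient_scale.
Proof. by move=> x; rewrite /quotient_scale scale1r quotient_pi1 mul1r. Qed.

Fact quotient_scaleDr : right_distributive quotient_scale +%R.
Proof. by move=> k x y; apply: mulrDr. Qed.

Fact quotient_scaleDl x : {morph quotient_scale^~ x : k l / k + l}.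
Proof. by move=> k l; rewrite /quotient_scale scalerDl quotient_piD mulrDl. Qed.

HB.instance Definition _ := GRing.Zmodule_isLmodule.Build K (quotient J)
  quotient_scaleA quotient_scale1 quotient_scaleDr quotient_scaleDl.

(* The ring and vector space structures form a K-algebra; the library's
   [algType] would in addition require 1 != 0. *)
Lemma quotient_scaleAl (k : K) (x y : quotient J) :
  k *: (x * y) = (k *: x) * y.
Proof. exact: mulrA. Qed.

Lemma quotient_scaleAr (k : K) (x y : quotient J) :
  k *: (x * y) = x * (k *: y).
Proof. by rewrite mulrC quotient_scaleAl mulrC. Qed.

End QuotientAlgebra.

(** * Exponent lattices *)

Definition kerZ d n (A : 'M[int]_(d, n)) : set 'cV[int]_n :=
  [set u | A *m u = 0].

Section Exponents.
Variables (R : realType) (d n : nat).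
Local Notation C := R[i].

Definition exponent_lattices (A : 'M[int]_(d, n)) (beta : 'cV[C]_d) :
    set (set 'cV[C]_n) :=
  [set Lam | exists2 lam : 'cV[C]_n, map_mx intr A *m lam = beta
           & Lam = [set lam + map_mx intr u | u in kerZ A]].

Definition dotZ (w : 'cV[R]_n) (u : 'cV[int]_n) : R :=
  \sum_j w j 0 * (u j 0)%:~R.

Definition generic (A : 'M[int]_(d, n)) (w : 'cV[R]_n) : Prop :=
  forall u, kerZ A u -> u != 0 -> dotZ w u != 0.

Definition nsupp (g : 'cV[C]_n) : {set 'I_n} :=
  [set j | `[< exists k : nat, g j 0 = - k.+1%:R >]]%SET.

Variable Lam : set 'cV[C]_n.

Definition stratum (I : {set 'I_n}) : set 'cV[C]_n :=
  [set g | Lam g /\ nsupp g = I].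

Definition NS : set {set 'I_n} := [set I | stratum I !=set0].

Definition MinNS : set {set 'I_n} :=
  [set I | NS I /\ forall J, NS J -> J \subset I -> J = I].

Variable w : 'cV[R]_n.

(* The elements of an exponent lattice differ by integral vectors, so those of
   [stratum I] are all written lam + u for a unique integral u. *)
Definition bounded_NS : set {set 'I_n} :=
  [set I | NS I /\ exists2 lam, Lam lam
         & has_lbound [set dotZ w u | u in [set u : 'cV[int]_n |
                         stratum I (lam + map_mx intr u)]]].

Definition unbounded_NS : set {set 'I_n} := NS `\` bounded_NS.

Definition bounded_MinNS : set {set 'I_n} := MinNS `&` bounded_NS.

End Exponents.

Definition admissible_lattices (R : realType) d n (A : 'M[int]_(d, n))
    (beta : 'cV[R[i]]_d) (w : 'cV[R]_n) : set (set 'cV[R[i]]_n) :=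
  [set Lam | exponent_lattices A beta Lam /\ bounded_MinNS Lam w !=set0].

(** * Local constraint ideals *)

(* The variable 'X_j of {mpoly R[i][n]} stands for the symbol of d/dy_j. *)
Section ConstraintIdeals.
Variables (R : realType) (d n : nat).
Local Notation S := {mpoly R[i][n]}.

Definition irrelevant_ideal : ideal S :=
  ideal_gen [set 'X_j | j in [set: 'I_n]].

Definition euler_ideal (A : 'M[int]_(d, n)) : ideal S :=
  ideal_gen [set \sum_j (A i j)%:~R *: ('X_j : S) | i in [set: 'I_d]].

Definition monomial_of (K : {set 'I_n}) : S := \prod_(j in K) 'X_j.

Variables (Lam : set 'cV[R[i]]_n) (w : 'cV[R]_n) (I : {set 'I_n}).

Definition boundary_ideal : ideal S :=
  ideal_gen [set monomial_of (J :\: I) | J in unbounded_NS Lam w].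

Definition constraint_ideal (A : 'M[int]_(d, n)) : ideal S :=
  ideal_add (euler_ideal A) boundary_ideal.

End ConstraintIdeals.

(* Main.v *)
Require Import Defs.
From mathcomp Require Import all_boot all_order all_algebra.
From mathcomp Require Import boolp classical_sets reals complex mpoly.
From HB Require Import structures.

Set Implicit Arguments.
Unset Strict Implicit.
Unset Printing Implicit Defensive.

Import Order.TTheory GRing.Theory Num.Theory.

Local Open Scope classical_set_scope.
Local Open Scope ring_scope.

(** Write [r] for the constraint ideal and [m] for the irrelevant ideal.  All the
    assertions follow from the two inclusions m^(n+1) <= r <= m.

    The inclusion r <= m ([constraint_ideal_proper]) is the minimality of [I]: no
    unbounded [J] is contained in [I], so the generators of the boundary ideal,
    like the Euler linear forms, have no constant term.

    For m^(n+1) <= r, the geometric input is [exists_unbounded_along]: moving from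
    a point of the stratum of [I] in the direction of a nonzero lattice vector [u]
    along which [w] decreases, one meets an unbounded [J] with J \ I contained in
    the support of [u].  So the boundary ideal contains every squarefree monomial
    whose support is that of a nonzero integral kernel vector of [A], that is,
    every squarefree monomial indexed by linearly dependent columns of [A], just
    as for the Stanley-Reisner ideal of a matroid.  On independent columns, the
    Euler forms allow each variable to be rewritten in terms of the variables
    outside a given independent set.  In a monomial of degree larger than [n] some
    variable is repeated, and rewriting one occurrence of it strictly enlarges the
    support of the monomial.  Iterating, the support becomes dependent and the
    monomial falls into [r] ([high_degree_monomial]).

    Such an ideal [r] has radical [m] since [m] is prime.  Its quotient is spanned
    by the monomials of degree at most [n], it is local because elements with
    nonzero constant term are invertible, and adding the monomials one at a time,
    by decreasing degree, filters it by submodules whose successive quotients are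
    zero or simple. *)

(** * Finite-dimensional spaces and local rings *)

(** A surjection from a coordinate space of least possible dimension is
    injective: a nonzero vector of its kernel would make the restriction to a
    complementary hyperplane still surjective. *)
Lemma finite_dimensional_of_surjection (K : fieldType) (V : lmodType K) (N : nat)
    (f : 'rV[K]_N -> V) :
  linear f -> (forall v, exists x, f x = v) -> finite_dimensional V.
Proof.
move=> f_lin f_surj.
pose P N := `[< exists g : 'rV[K]_N -> V,
                  linear g /\ forall v, exists x, g x = v >].
have exP : exists N, P N by exists N; apply/asboolP; exists f.
case: (ex_minnP exP) => N0 /asboolP[g [g_lin g_surj]] N0_min.
pose gL : {linear 'rV[K]_N0 -> V} :=
  HB.pack g (GRing.isLinear.Build _ _ _ _ g g_lin).
have g_inj : injective g.
  suff ker0 x : g x = 0 -> x = 0.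
    move=> x y gxy; apply/eqP; rewrite -subr_eq0; apply/eqP/ker0.
    by rewrite -[g]/(gL : _ -> _) linearB /= gxy subrr.
  move=> gx0; apply/eqP/negPn/negP => x0.
  have rx : \rank x = 1%N by rewrite rank_rV x0.
  have : P (\rank (x^C)%MS).
    apply/asboolP; exists (g \o mulmxr (row_base (x^C)%MS)); split.
      by move=> a u v /=; rewrite -g_lin mulmxDl scalemxAl.
    move=> v; have [z gz] := g_surj v.
    have : (z <= x + x^C)%MS by rewrite submx_full ?addsmx_compl_full.
    case/sub_addsmxP => -[a b] /= zE.
    have : (b *m x^C <= row_base (x^C)%MS)%MS by rewrite eq_row_base submxMl.
    case/submxP => y yE; exists y => /=; rewrite -yE -gz zE.
    rewrite [a]mx11_scalar mul_scalar_mx.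
    by rewrite -[X in _ = X]/(gL _) linearD linearZ /= gx0 scaler0 add0r.
  move/N0_min; rewrite mxrank_compl rx.
  have := rank_leq_col x; rewrite rx.
  by case: (N0) => // k _; rewrite subn1 ltnn.
have [h hK] := choice g_surj.
have gK : cancel g h by move=> x; apply: g_inj; rewrite hK.
exists N0, h; split; last by exists g.
by move=> a u v; apply: g_inj; rewrite hK g_lin !hK.
Qed.

Lemma local_ring_of_greatest_proper_ideal (A : comPzRingType) (M : set A) :
  is_ideal M -> M <> setT ->
  (forall N : set A, is_ideal N -> N <> setT -> N `<=` M) -> local_ring A.
Proof.
move=> Mid MT Mmax; exists M; split.
  by split=> // N Nid MN NT; apply/seteqP; split=> //; apply: Mmax.
move=> M' [M'id M'T M'max]; apply: M'max => //.
exact: Mmax.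
Qed.

(** * Composition series *)

Section CompositionSeries.
Variables (A : pzRingType) (V : lmodType A).

Definition composition_series_to (N : set V) : Prop :=
  exists (l : nat) (M : nat -> set V),
    [/\ M 0%N = [set 0], M l = N
      & forall i, (i < l)%N ->
        [/\ is_submodule (M i), is_submodule (M i.+1), M i `<` M i.+1
          & forall P, is_submodule P -> M i `<=` P -> P `<=` M i.+1 ->
              P = M i \/ P = M i.+1]].

Lemma composition_series_to0 : composition_series_to [set 0].
Proof. by exists 0%N, (fun=> [set 0]). Qed.

(** Inclusions that turn out to be equalities are skipped, so a chain may be
    extended without first deciding which of its steps are strict. *)
Lemma composition_series_to_extend (N N' : set V) :
    is_submodule N -> is_submodule N' -> N `<=` N' ->
    (forall P, is_submodule P -> N `<=` P -> P `<=` N' -> P = N \/ P = N') ->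
  composition_series_to N -> composition_series_to N'.
Proof.
move=> Nsub N'sub NN' cover [l [M [M0 Ml Mstep]]].
have [<-|neqNN'] := pselect (N = N'); first by exists l, M.
exists l.+1, (fun i => if (i <= l)%N then M i else N').
rewrite ltnn; split=> // i; rewrite ltnS; case: ltngtP => // [lt_il|->] _.
  exact: Mstep.
rewrite Ml; split=> //.
by split=> // N'N; apply: neqNN'; apply/seteqP.
Qed.

End CompositionSeries.

(** * Monomial ideals *)

Lemma ideal_sum (A : comPzRingType) (N : set A) (T : Type) (r : seq T)
    (P : pred T) (F : T -> A) :
  is_ideal N -> (forall i, P i -> N (F i)) -> N (\sum_(i <- r | P i) F i).
Proof. by move=> [N0 ND _] NF; elim/big_ind: _. Qed.

Lemma ideal_gen_sub (A : comPzRingType) (G : set A) (N : set A) :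
  is_ideal N -> G `<=` N -> ideal_gen G `<=` N.
Proof. by move=> Nid GN x; apply. Qed.

Section MonomialIdeals.
Variables (n : nat) (K : fieldType).
Local Notation S := {mpoly K[n]}.

(** When [Q] is closed under multiplication by monomials, this is the monomial
    ideal spanned by the monomials with exponent in [Q].  The irrelevant ideal
    and its powers are the cases [degree_ge 1] and [degree_ge k]. *)
Definition supported_in (Q : set 'X_{1..n}) : set S :=
  [set p | forall m, m \in msupp p -> Q m].

Definition upward_closed (Q : set 'X_{1..n}) : Prop :=
  forall m m', Q m -> Q (m + m')%MM.

Lemma supported_in_ideal Q : upward_closed Q -> is_ideal (supported_in Q).
Proof.
move=> Qup; split=> [m|p q Qp Qq m|a p Qp m].
- by rewrite msupp0.
- by move=> /msuppD_le; rewrite mem_cat => /orP[/Qp|/Qq].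
move=> /msuppM_le /allpairsP[[m1 m2] /= [_ /Qp Qm2 ->]].
by rewrite addmC; apply: Qup.
Qed.

Definition degree_ge (k : nat) : set 'X_{1..n} := [set m | (k <= mdeg m)%N].

Lemma degree_ge_upward_closed k : upward_closed (degree_ge k).
Proof.
move=> m m'; rewrite /degree_ge /= mdegD => /leq_trans; apply.
exact: leq_addr.
Qed.

Lemma supported_in_degree_ge1 (p : S) :
  supported_in (degree_ge 1) p <-> p@_0 = 0.
Proof.
split=> [Qp|p0 m mp].
  apply/eqP; rewrite mcoeff_eq0; apply/negP => /Qp.
  by rewrite /degree_ge /= mdeg0.
rewrite /degree_ge /= lt0n mdeg_eq0; apply: contraTneq mp => ->.
by rewrite -mcoeff_eq0 p0.
Qed.

Lemma supported_in_degree_geX k (p : S) :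
  p@_0 = 0 -> supported_in (degree_ge k) (p ^+ k).
Proof.
move=> /supported_in_degree_ge1 p1; elim: k => [//|k IHk] m.
rewrite exprS => /msuppM_le /allpairsP[[m1 m2] /= [/p1 m1_ge1 /IHk m2_gek ->]].
by rewrite /degree_ge /= mdegD -add1n leq_add.
Qed.

Lemma mcoeff0M (p q : S) : (p * q)@_0 = p@_0 * q@_0.
Proof. exact: (rmorphM (mcoeff 0%MM)). Qed.

Lemma supported_in_sub (Q : set 'X_{1..n}) (N : set S) :
  is_ideal N -> (forall m, Q m -> N 'X_[m]) -> supported_in Q `<=` N.
Proof.
move=> Nid NX p Qp; rewrite [p]mpolyE big_seq; apply: ideal_sum => // m mp.
by have [_ _ NM] := Nid; rewrite -mul_mpolyC; apply/NM/NX/Qp.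
Qed.

End MonomialIdeals.

(** * Proper ideals containing a power of the irrelevant ideal *)

Section IrrelevantPrimaryIdeals.
Variables (n : nat) (K : fieldType).
Local Notation S := {mpoly K[n]}.
Variables (J : ideal S) (k : nat).
Hypothesis J_proper : forall p, (J : set S) p -> p@_0 = 0.
Hypothesis J_deg : supported_in (@degree_ge n k) `<=` J.

Local Notation pi := (quotient_pi J).

Lemma radical_irrelevant : radical J = supported_in (@degree_ge n 1).
Proof.
apply/seteqP; split=> p /=.
  case=> l /J_proper pl0; apply/supported_in_degree_ge1/eqP.
  have: p@_0 ^+ l == 0 by rewrite -(rmorphXn (mcoeff 0%MM)) /= pl0.
  by rewrite expf_eq0 => /andP[].
move=> /supported_in_degree_ge1 p0; exists k.
by apply/J_deg/supported_in_degree_geX.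
Qed.

Lemma quotient_pi0 : pi 0 = 0.
Proof. by apply: (addIr (pi 0)); rewrite -quotient_piD !add0r. Qed.

Lemma quotient_nonzero : (1 : quotient J) != 0.
Proof.
apply/eqP; rewrite -quotient_pi0 => /quotient_piP/J_proper/eqP.
by rewrite subr0 mcoeff1 eqxx oner_eq0.
Qed.

Lemma quotient_piZ (c : K) p : pi (c *: p) = c *: pi p.
Proof. by rewrite -[RHS]/(pi c%:A * pi p) -quotient_piM -scalerAl mul1r. Qed.

(** The finitely many monomials of degree less than [k] span the quotient. *)
Lemma quotient_finite_dimensional :
  finite_dimensional (quotient J : lmodType K).
Proof.
pose f (y : 'rV[K]_#|{: 'X_{1..n < k}}|) : quotient J :=
  pi (\sum_i y 0 i *: 'X_[enum_val i]).
apply: (finite_dimensional_of_surjection (f := f)).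
  move=> a u v; rewrite /f -quotient_piZ -quotient_piD scaler_sumr -big_split.
  by congr pi; apply: eq_bigr => i _; rewrite !mxE scalerDl scalerA.
move=> v; rewrite -(quotient_reprK v); set p := quotient_repr v.
exists (\row_(i < #|{: 'X_{1..n < k}}|) p@_(enum_val i)).
apply/quotient_piP/J_deg => m.
rewrite /degree_ge /= leqNgt; apply: contraTN => m_lt.
rewrite -mcoeff_eq0 mcoeffB raddf_sum /= subr_eq0; apply/eqP.
under eq_bigr do rewrite mxE mcoeffZ mcoeffX.
rewrite -(big_enum_val (fun m' : 'X_{1..n < k} =>
            p@_m' * (m' == m :> 'X_{1..n})%:R)).
rewrite (bigD1 (BMultinom m_lt)) //= eqxx mulr1 big1 ?addr0 // => m' m'm.
rewrite [_ == m](_ : _ = false) ?mulr0 //.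
by apply: contra_neqF m'm => /eqP m'm; apply: val_inj.
Qed.

Definition quotient_image (Q : set S) : set (quotient J) := [set pi p | p in Q].

Lemma quotient_image_submodule Q :
  is_ideal Q -> is_submodule (quotient_image Q : set (quotient_module J)).
Proof.
move=> [Q0 QD QM]; split.
- by exists 0; last exact: quotient_pi0.
- move=> _ _ [p Qp <-] [q Qq <-]; exists (p + q); first exact: QD.
  exact: quotient_piD.
- move=> a _ [p Qp <-]; exists (a * p); first exact: QM.
  exact: quotient_piM.
Qed.

Lemma quotient_image_ideal Q : is_ideal Q -> is_ideal (quotient_image Q).
Proof.
move=> Qid; have [im0 imD imM] := quotient_image_submodule Qid.
split=> // a x imx.
by rewrite -(quotient_reprK a); apply: (imM (quotient_repr a)).
Qed.

(** Outside the image of the irrelevant ideal everything is invertible: up to a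
    nonzero scalar such a class is 1 - q with q in the irrelevant ideal, and the
    geometric series in q is finite because q ^+ k lies in [J]. *)
Lemma quotient_local : local_ring (quotient J).
Proof.
apply: (@local_ring_of_greatest_proper_ideal _
          (quotient_image (supported_in (@degree_ge n 1)))).
- exact/quotient_image_ideal/supported_in_ideal/degree_ge_upward_closed.
- move=> imT; have: [set: quotient J] 1 by [].
  rewrite -imT => -[p /supported_in_degree_ge1 p0 /quotient_piP/J_proper].
  move/eqP; rewrite mcoeffB p0 mcoeff1 eqxx sub0r oppr_eq0.
  by rewrite oner_eq0.
move=> N [N0 ND NM] NT x Nx; exists (quotient_repr x); last exact: quotient_reprK.
apply/supported_in_degree_ge1/eqP/negPn/negP => c_neq0; apply: NT.
set p := quotient_repr x in c_neq0; set c := p@_0 in c_neq0.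
pose q := 1 - c^-1 *: p.
have q0 : q@_0 = 0.
  by rewrite mcoeffB mcoeffZ mcoeff1 eqxx mulVf ?subrr.
have invp : pi 1 = pi (c^-1 *: \sum_(i < k) q ^+ i) * x.
  rewrite -(quotient_reprK x) -/p -quotient_piM; apply/quotient_piP.
  have -> : 1 - c^-1 *: (\sum_(i < k) q ^+ i) * p = q ^+ k.
    rewrite -scalerAl mulrC scalerAl.
    have -> : c^-1 *: p = - (q - 1) by rewrite /q addrAC subrr sub0r opprK.
    by rewrite mulNr -subrX1 opprK addrC subrK.
  exact/J_deg/supported_in_degree_geX.
apply/seteqP; split=> // y _; rewrite -[y]mulr1 -quotient_pi1 invp.
by apply/NM/NM.
Qed.

Definition has_series (Q : set 'X_{1..n}) : Prop :=
  composition_series_to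
    (quotient_image (supported_in Q) : set (quotient_module J)).

(** Modulo the smaller submodule, the class of ['X_[m0]] is killed by every
    variable, so it spans at most a line and no submodule fits strictly in
    between. *)
Lemma quotient_image_composition_step (Q : set 'X_{1..n}) (m0 : 'X_{1..n}) :
    upward_closed Q -> (forall m, m != 0%MM -> Q (m0 + m)%MM) ->
  has_series Q -> has_series (m0 |` Q).
Proof.
move=> Qup Qm0; set Q' := m0 |` Q.
have Q'up : upward_closed Q'.
  move=> m m' [->|Qm]; last by right; apply: Qup.
  by have [->|m'0] := eqVneq m' 0%MM; [left; rewrite addm0|right; apply: Qm0].
have Q'decomp (p : S) : supported_in Q' p -> supported_in Q (p - p@_m0 *: 'X_[m0]).
  move=> Q'p m; rewrite mcoeff_msupp mcoeffB mcoeffZ mcoeffX.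
  have [<-|m0m] := eqVneq m0 m; first by rewrite mulr1 subrr eqxx.
  rewrite mulr0 subr0 -mcoeff_msupp => /Q'p[mm0|//].
  by rewrite mm0 eqxx in m0m.
apply: composition_series_to_extend.
- exact/quotient_image_submodule/supported_in_ideal.
- exact/quotient_image_submodule/supported_in_ideal.
- by move=> _ [p Qp <-]; exists p => // m /Qp; right.
move=> N [N0 ND NM] QN NQ'.
have [NQ|] := pselect (N `<=` quotient_image (supported_in Q)).
  by left; apply/seteqP.
move=> /existsNP[x /not_implyP[Nx xNQ]]; right; apply/seteqP; split=> //.
have [p Q'p px] := NQ' _ Nx; set c := p@_m0.
have c0 : c != 0.
  apply: contra_notN xNQ => /eqP c0; exists p => //.
  by have := Q'decomp p Q'p; rewrite -/c c0 scale0r subr0.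
have NX : N (pi 'X_[m0]).
  have -> : pi 'X_[m0] = c^-1%:MP *: (pi p : quotient_module J)
              + (- c^-1)%:MP *: (pi (p - c *: 'X_[m0]) : quotient_module J).
    rewrite -[RHS]/(pi c^-1%:MP * pi p + pi (- c^-1)%:MP * pi (p - c *: 'X_[m0])).
    rewrite -!quotient_piM -quotient_piD; congr pi.
    rewrite !mul_mpolyC scaleNr scalerBr opprB scalerA mulVf // scale1r.
    by rewrite addrC subrK.
  apply: ND; apply: NM; first by rewrite px.
  by apply: QN; exists (p - c *: 'X_[m0]) => //; apply: Q'decomp.
move=> _ [q Q'q <-].
have -> : pi q = (pi (q - q@_m0 *: 'X_[m0]) : quotient_module J)
                 + (q@_m0)%:MP *: (pi 'X_[m0] : quotient_module J).
  rewrite -[RHS]/(pi (q - q@_m0 *: 'X_[m0]) + pi (q@_m0)%:MP * pi 'X_[m0]).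
  by rewrite -quotient_piM -quotient_piD mul_mpolyC subrK.
apply: ND; last exact: NM.
by apply: QN; exists (q - q@_m0 *: 'X_[m0]) => //; apply: Q'decomp.
Qed.

(** Monomials are added one at a time, by decreasing degree, starting from the
    degrees at least [k], whose image is zero. *)
Lemma quotient_finite_length :
  finite_length (quotient_module J : lmodType S).
Proof.
have ser_k : has_series (@degree_ge n k).
  rewrite /has_series [quotient_image _](_ : _ = [set 0]).
    exact: composition_series_to0.
  apply/seteqP; split=> [_ [p /J_deg Jp <-]|_ ->].
    by rewrite /= -quotient_pi0; apply/quotient_piP; rewrite subr0.
  by exists 0; [move=> m; rewrite msupp0|exact: quotient_pi0].
have ser_step j : has_series (@degree_ge n j.+1) -> has_series (@degree_ge n j).
  move=> ser_j.
  have ser_s (s : seq 'X_{1..n}) :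
      has_series (@degree_ge n j.+1 `|` [set m | m \in s /\ mdeg m = j]).
    elim: s => [|m0 s IHs].
      by rewrite [X in _ `|` X](_ : _ = set0) ?setU0 // -subset0 => m [].
    have [degm0|degm0] := eqVneq (mdeg m0) j; last first.
      congr (has_series (_ `|` _)): IHs; apply/seteqP.
      split=> m /= [ms mj]; split=> //; first by rewrite inE ms orbT.
      by move: ms; rewrite inE => /predU1P[mm0|//]; rewrite -mm0 mj eqxx in degm0.
    rewrite [X in has_series X](_ : _ = m0 |`
              (@degree_ge n j.+1 `|` [set m | m \in s /\ mdeg m = j])).
      apply: quotient_image_composition_step => //.
        move=> m m' [mj|[ms mj]]; first by left; apply: degree_ge_upward_closed.
        have [->|m'0] := eqVneq m' 0%MM; first by right; rewrite /= addm0.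
        by left; rewrite /degree_ge /= mdegD mj -addn1 leq_add2l lt0n mdeg_eq0.
      move=> m m0'; left.
      by rewrite /degree_ge /= mdegD degm0 -addn1 leq_add2l lt0n mdeg_eq0.
    apply/seteqP; split=> m /=.
      case=> [|[]]; first by right; left.
      by rewrite inE => /predU1P[->|ms] mj; [left|right; right].
    case=> [->|[|[ms mj]]]; [|by left|]; right; rewrite inE ?eqxx //.
    by rewrite ms orbT.
  have := ser_s [seq val m | m : 'X_{1..n < j.+1}]; congr has_series.
  apply/seteqP; split=> m /=.
    by case=> [/ltnW|[_ <-]]; rewrite /degree_ge /=.
  rewrite /degree_ge /= leq_eqVlt => /predU1P[jm|]; [right|by left].
  split=> //; have mj : (mdeg m < j.+1)%N by rewrite -jm.
  by apply/mapP; exists (BMultinom mj); rewrite ?mem_enum.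
have ser_0 : has_series (@degree_ge n 0) by elim: (k) ser_k => // j IHj /ser_step.
congr composition_series_to: ser_0; apply/seteqP; split=> // x _.
by exists (quotient_repr x) => //; apply: quotient_reprK.
Qed.

End IrrelevantPrimaryIdeals.
(** * Integral relations between the columns of a matrix *)

Lemma clear_denominators n (v : 'cV[rat]_n) :
  exists (D : int) (u : 'cV[int]_n), D != 0 /\ map_mx intr u = D%:~R *: v.
Proof.
exists (\prod_i denq (v i 0)).
exists (\col_i (numq (v i 0) * \prod_(k | k != i) denq (v k 0))); split.
  by apply/prodf_neq0 => i _; apply: denq_neq0.
apply/colP => i; rewrite !mxE [in RHS](bigD1 i) //= !intrM numqE.
by rewrite -[LHS]mulrA [RHS]mulrC.
Qed.

Definition supp n (u : 'cV[int]_n) : {set 'I_n} := [set j | u j 0 != 0]%SET.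

(** Let [B] be [A] with the columns outside [F] erased.  Either the [j]-th unit
    row vector is in the row space of [B], or some vector annihilated by [B] has
    a nonzero [j]-th coordinate, and its restriction to [F] is a rational kernel
    vector of [A]. *)
Lemma kernel_vector_or_elimination d n (A : 'M[int]_(d, n)) (F : {set 'I_n})
    (j : 'I_n) :
    j \in F ->
  (exists u, [/\ kerZ A u, u != 0 & supp u \subset F]) \/
  (exists y : 'rV[rat]_d, forall k, k \in F ->
     (y *m map_mx intr A) 0 k = (k == j)%:R).
Proof.
move=> jF; pose D : 'M[rat]_n := diag_mx (\row_k (k \in F)%:R).
pose B := map_mx intr A *m D.
have [/submxP[y yE]|] := boolP ((delta_mx 0 j : 'rV[rat]_n) <= B)%MS.
  right; exists y => k kF; move/rowP/(_ k): yE.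
  by rewrite mulmxA mul_mx_diag !mxE eqxx kF mulr1 eq_sym => ->.
rewrite submxE; move: (cokermx B) (mulmx_coker B) => N BN nz; left.
have [k vk] : exists k, N j k != 0.
  apply: contrapT => z; case/eqP: nz; apply/rowP => k; rewrite -rowE !mxE.
  by apply/eqP/negPn/negP => vk; apply: z; exists k.
have [c [u [c0 uE]]] := clear_denominators (D *m col k N).
have uk i : (u i 0)%:~R = c%:~R * ((i \in F)%:R * N i k) :> rat.
  by move/colP/(_ i): uE; rewrite mul_diag_mx !mxE.
exists u; split.
- suff : map_mx intr (A *m u) = 0 :> 'cV[rat]_d.
    move/colP=> Au; apply/colP => i; move: (Au i); rewrite !mxE => /eqP.
    by rewrite intr_eq0 => /eqP.
  by rewrite map_mxM uE -scalemxAr mulmxA -/B colE mulmxA BN mul0mx scaler0.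
- apply: contraNneq vk => u0; have := uk j.
  rewrite u0 jF mxE mul1r => /esym/eqP.
  by rewrite mulf_eq0 intr_eq0 (negPf c0).
- apply/fintype.subsetP => i; rewrite inE; apply: contraR => iF.
  by have := uk i; rewrite (negPf iF) mul0r mulr0 => /eqP; rewrite intr_eq0.
Qed.

(** * Unbounded negative supports along a lattice direction *)

Section Lattice.
Variables (R : realType) (d n : nat).
Local Notation C := R[i].
Local Notation S := {mpoly C[n]}.
Variables (A : 'M[int]_(d, n)) (beta : 'cV[C]_d) (w : 'cV[R]_n).
Variables (Lam : set 'cV[C]_n) (I : {set 'I_n}).
Hypotheses (hw : generic A w) (hLam : exponent_lattices A beta Lam).

Lemma dotZD u v : dotZ w (u + v) = dotZ w u + dotZ w v.
Proof.
by rewrite /dotZ -big_split; apply: eq_bigr => j _; rewrite mxE intrD mulrDr.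
Qed.

Lemma dotZMn u m : dotZ w (u *+ m) = dotZ w u *+ m.
Proof.
elim: m => [|m IHm]; last by rewrite !mulrS dotZD IHm.
by rewrite /dotZ big1 // => j _; rewrite mxE mulr0.
Qed.

Lemma dotZN u : dotZ w (- u) = - dotZ w u.
Proof.
by rewrite /dotZ -sumrN; apply: eq_bigr => j _; rewrite mxE intrN mulrN.
Qed.

Lemma lattice_translate g u : Lam g -> kerZ A u -> Lam (g + map_mx intr u).
Proof.
case: hLam => lam _ -> [v Av <-] Au; exists (v + u); last by rewrite map_mxD addrA.
by rewrite /kerZ /= mulmxDr Av Au addr0.
Qed.

Lemma lattice_diff g h : Lam g -> Lam h ->
  exists2 u : 'cV[int]_n, kerZ A u & g = h + map_mx intr u.
Proof.
case: hLam => lam _ -> [u Au <-] [v Av <-]; exists (u - v).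
  by rewrite /kerZ /= mulmxBr Au Av subr0.
by rewrite map_mxB addrACA subrr addr0.
Qed.

(** As [w] is generic it does not vanish on [u]; replacing [u] by its opposite,
    assume that it is negative there, and follow the ray [g + m u] from a point [g] of the stratum of [I].  A coordinate that
    [u] does not move has the same sign type all along the ray, so all negative
    supports met lie in the union of [I] and [supp u].  There are finitely many
    of them while [w] decreases to minus infinity along the ray, so [w] is
    unbounded below on one of their strata. *)
Lemma exists_unbounded_along u :
    NS Lam I -> kerZ A u -> u != 0 ->
  exists2 J, unbounded_NS Lam w J & J :\: I \subset supp u.
Proof.
wlog wu : u / dotZ w u < 0 => [IH NSI Au u0|].
  have [wu|wu|wu] := ltgtP (dotZ w u) 0; first exact: IH.
    have [||||J JU Jsupp] := IH (- u) => //.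
    - by rewrite dotZN oppr_lt0.
    - by rewrite /kerZ /= mulmxN Au oppr0.
    - by rewrite oppr_eq0.
    exists J => //; apply: fintype.subset_trans Jsupp _.
    by apply/fintype.subsetP => j; rewrite !inE mxE oppr_eq0.
  by have := hw Au u0; rewrite wu eqxx.
move=> [g [Lamg nsg]] Au u0.
pose gm m := g + map_mx intr (u *+ m).
have Lamgm m : Lam (gm m).
  apply: lattice_translate => //.
  by rewrite /kerZ /= [LHS](raddfMn (mulmx A)) /= Au mul0rn.
have supp_gm m : nsupp (gm m) :\: I \subset supp u.
  apply/fintype.subsetP => j; rewrite !inE -nsg inE => /andP[jI].
  apply: contraTneq => uj0; apply: contra jI => /asboolP[k gmk].
  apply/asboolP; exists k.
  by rewrite -gmk mxE [X in _ = _ + X]mxE mulmxnE uj0 mul0rn addr0.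
apply: contrapT => noJ.
(* A stratum that the ray avoids gets the vacuous bound 0. *)
have bnd J : exists c : R, forall m, nsupp (gm m) = J -> c <= dotZ w u *+ m.
  have [[m0 gm0]|nJ] := pselect (exists m0, nsupp (gm m0) = J); last first.
    by exists 0 => m gmJ; case: nJ; exists m.
  have NSJ : NS Lam J by exists (gm m0).
  have /contrapT[_ [lam Lamlam [c cP]]] : ~ ~ bounded_NS Lam w J.
    by move=> nbJ; apply: noJ; exists J; [split|rewrite -gm0 supp_gm].
  have [v Av gE] := lattice_diff Lamg Lamlam.
  exists (c - dotZ w v) => m gmJ; rewrite lerBlDl -dotZMn -dotZD.
  apply: cP; exists (v + u *+ m) => //=; rewrite map_mxD addrA -gE.
  by split; [exact: Lamgm|].
have [c cP] := choice bnd.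
(* The sum of the absolute values bounds all the finitely many [c J] at once. *)
have [m] : exists m : nat, \sum_J `|c J| < m%:R * - dotZ w u.
  exists (Num.bound (\sum_J `|c J| / - dotZ w u)); rewrite -ltr_pdivrMr ?oppr_gt0 //.
  rewrite mulr_suml archi_boundP // sumr_ge0 // => J _.
  by rewrite divr_ge0 // oppr_ge0 ltW.
rewrite ltNge => /negP; apply; rewrite mulrN mulr_natl.
rewrite (bigD1 (nsupp (gm m))) //= ler_wpDr ?sumr_ge0 //.
rewrite lerNl; apply: le_trans (cP (nsupp (gm m)) m erefl).
by rewrite lerNl -normrN ler_norm.
Qed.

End Lattice.

(** * The local constraint ideal *)

Section ConstraintIdeal.
Variables (R : realType) (d n : nat).
Local Notation C := R[i].
Local Notation S := {mpoly C[n]}.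

Lemma irrelevant_idealE :
  irrelevant_ideal R n = supported_in (@degree_ge n 1) :> set S.
Proof.
have Mid := supported_in_ideal C (@degree_ge_upward_closed n 1).
apply/seteqP; split.
  apply: ideal_gen_sub => // _ [j _ <-].
  by apply/supported_in_degree_ge1; rewrite mcoeffX mnm1_eq0.
apply: supported_in_sub; first exact: ideal_setP.
move=> m; rewrite /degree_ge /= lt0n mdeg_eq0 => m0.
have [j mj] : exists j, m j != 0%N.
  apply: contrapT => mj; case/eqP: m0; apply/mnmP => j; rewrite mnm0E.
  by apply/eqP/negPn/negP => mj0; apply: mj; exists j.
move: mj; rewrite -lep1mP => /submK <-; rewrite mpolyXD.
have [_ _ IM] := ideal_setP (irrelevant_ideal R n).
by apply: IM => N [_]; apply; exists j.
Qed.

Definition msupport (m : 'X_{1..n}) : {set 'I_n} := [set j | m j != 0%N]%SET.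

Lemma monomial_of_mem (N : set S) (K : {set 'I_n}) m :
  is_ideal N -> N (monomial_of R K) -> K \subset msupport m -> N 'X_[m].
Proof.
move=> [_ _ NM] NK /fintype.subsetP Km.
have le_m : ((\sum_(j in K) U_(j)) <= m)%MM.
  apply/mnm_lepP => j; rewrite mnm_sumE.
  under eq_bigr do rewrite mnm1E.
  have [jK|jK] := boolP (j \in K).
    rewrite (bigD1 j) //= eqxx big1 ?addn0 => [|i /andP[_ /negPf->] //].
    by have := Km j jK; rewrite inE lt0n.
  by rewrite big1 // => i iK; case: eqP => // ij; rewrite -ij iK in jK.
rewrite -(submK le_m) mpolyXD -mprodXE; exact: NM.
Qed.

Variables (A : 'M[int]_(d, n)) (beta : 'cV[C]_d) (w : 'cV[R]_n).
Variables (Lam : set 'cV[C]_n) (I : {set 'I_n}).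

Local Notation r := (constraint_ideal Lam w I A).

Lemma euler_ideal_sub : euler_ideal R A `<=` r.
Proof.
move=> x ex; exists x => //; exists 0; last by rewrite addr0.
by have [] := ideal_setP (boundary_ideal Lam w I).
Qed.

Lemma boundary_ideal_sub : boundary_ideal Lam w I `<=` r.
Proof.
move=> x bx; exists 0; last by exists x; rewrite ?add0r.
by have [] := ideal_setP (euler_ideal R A).
Qed.

Lemma euler_row_combination (y : 'rV[rat]_d) :
  (euler_ideal R A : set S)
    (\sum_k ratr ((y *m map_mx intr A) 0 k) *: ('X_k : S)).
Proof.
have eid := ideal_setP (euler_ideal R A).
rewrite (_ : \sum_k _ = \sum_i ratr (y 0 i) *: \sum_k (A i k)%:~R *: ('X_k : S)).
  apply: ideal_sum => // i _; have [_ _ eM] := eid.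
  by rewrite -mul_mpolyC; apply: eM => N [_]; apply; exists i.
under [RHS]eq_bigr do rewrite scaler_sumr.
rewrite exchange_big /=; apply: eq_bigr => k _.
rewrite mxE rmorph_sum scaler_suml; apply: eq_bigr => i _.
by rewrite mxE rmorphM rmorph_int scalerA.
Qed.

(** By induction on the number of variables missing from the monomial.  If its
    support [F] contains that of a nonzero lattice vector, the monomial is a
    multiple of a generator of the boundary ideal.  Otherwise each ['X_j] with [j]
    in [F] is, modulo the Euler ideal, a linear combination of variables outside
    [F].  As the degree exceeds the number of variables, some ['X_j] divides the
    monomial twice; substituting for one of its two occurrences leaves the
    support intact and adds one variable to it, in each resulting term. *)
Lemma high_degree_monomial (m : 'X_{1..n}) :
    generic A w -> exponent_lattices A beta Lam -> NS Lam I ->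
  (n < mdeg m)%N -> (r : set S) 'X_[m].
Proof.
move=> hw hLam NSI; have rid := ideal_setP r; have [r0 rD rM] := rid.
have [N] := ubnP (n - #|msupport m|); elim: N m => // N IHN m leN m_big.
set F := msupport m in leN.
have [j mj2] : exists j, (1 < m j)%N.
  apply: contrapT => mle1; move: m_big; rewrite ltnNge mdegE => /negP; apply.
  rewrite -[leqRHS]card_ord -sum1_card leq_sum // => j _.
  by rewrite leqNgt; apply/negP => mj; apply: mle1; exists j.
have jF : j \in F by rewrite inE -lt0n ltnW.
have [[u [Au u0 uF]]|[y yF]] := kernel_vector_or_elimination A jF.
  have [J JU Jsub] := exists_unbounded_along hw hLam NSI Au u0.
  apply: (monomial_of_mem rid _ (fintype.subset_trans Jsub uF)).
  by apply: boundary_ideal_sub => N0 [_]; apply; exists J.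
pose m' := (m - U_(j))%MM.
have mE : m = (m' + U_(j))%MM by rewrite submK // lep1mP -lt0n ltnW.
pose c k : C := ratr ((y *m map_mx intr A) 0 k).
have -> : 'X_[m] = 'X_[m'] * (\sum_k c k *: 'X_k)
                   + \sum_(k | k \notin F) (- c k)%:MP * 'X_[m' + U_(k)] :> S.
  rewrite mulr_sumr (bigID (mem F)) /= (bigD1 j) //= big1 => [|k /andP[kF kj]].
    rewrite addr0 /c yF // eqxx rmorph1 scale1r -mpolyXD -mE -addrA -big_split /=.
    rewrite big1 ?addr0 // => k kF.
    by rewrite mul_mpolyC mpolyXD -scalerAr scaleNr subrr.
  by rewrite /c yF // (negPf kj) rmorph0 scale0r mulr0.
apply: rD; first by apply: rM; apply: euler_ideal_sub; apply: euler_row_combination.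
apply: ideal_sum => // k kF; apply: rM; apply: IHN; last first.
  by rewrite mdegD mdeg1; move: m_big; rewrite {1}mE mdegD mdeg1.
have -> : msupport (m' + U_(k)) = (k |: F)%SET.
  apply/setP => i; rewrite !inE mnmDE mnmBE !mnm1E (eq_sym i).
  have [_|_] := eqVneq k i; first by rewrite addn1.
  rewrite addn0; have [<-|_] := eqVneq j i; last by rewrite subn0.
  by rewrite -!lt0n subn_gt0 mj2 ltnW.
have FC : (#|k |: F|%SET <= n)%N by rewrite -[leqRHS]card_ord max_card.
move: leN FC; rewrite cardsU1 kF add1n !ltnS => leN FC.
by apply: leq_trans leN; rewrite ltn_sub2l.
Qed.

(** No [J] with unbounded stratum is contained in [I]: by minimality of [I] it
    would be equal to [I], whose stratum is bounded.  Hence every generator of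
    the boundary ideal is a nontrivial monomial. *)
Lemma constraint_ideal_proper :
  bounded_MinNS Lam w I -> forall p : S, (r : set S) p -> p@_0 = 0.
Proof.
move=> [[NSI Imin] Ibnd] p rp; apply/supported_in_degree_ge1.
have Mid := supported_in_ideal C (@degree_ge_upward_closed n 1).
have [_ MD MM] := Mid.
case: rp => e ee [b bb <-]; apply: MD.
- apply: ideal_gen_sub ee => // _ [i _ <-]; apply: ideal_sum => // j _.
  rewrite -mul_mpolyC; apply: MM.
  by apply/supported_in_degree_ge1; rewrite mcoeffX mnm1_eq0.
- apply: ideal_gen_sub bb => // _ [J [NSJ Junb] <-].
  have /set0Pn[j jJI] : J :\: I != finset.set0.
    by rewrite finset.setD_eq0; apply/negP => JI; apply: Junb; rewrite (Imin J).
  apply/supported_in_degree_ge1.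
  by rewrite /monomial_of (bigD1 j) //= mcoeff0M mcoeffX mnm1_eq0 mul0r.
Qed.

End ConstraintIdeal.

Theorem theorem5p3 (R : realType) (d n : nat) (A : 'M[int]_(d, n))
    (hA : \rank (map_mx intr A : 'M[rat]_(d, n)) = d)
    (beta : 'cV[R[i]]_d) (w : 'cV[R]_n) (hw : generic A w)
    (Lam : set 'cV[R[i]]_n) (hLam : admissible_lattices A beta w Lam)
    (I : {set 'I_n}) (hI : bounded_MinNS Lam w I) :
  let r := constraint_ideal Lam w I A in
  [/\ radical r = irrelevant_ideal R n,
      (1 : quotient r) != 0,
      finite_dimensional (quotient r : lmodType R[i]),
      local_ring (quotient r)
    & finite_length (quotient_module r : lmodType {mpoly R[i][n]})].
Proof.
move=> r; have r_proper := constraint_ideal_proper (A := A) hI.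
have r_deg : supported_in (@degree_ge n n.+1) `<=` r.
  apply: supported_in_sub; first exact: ideal_setP.
  have [LamL _] := hLam; have [[NSI _] _] := hI.
  by move=> m; apply: high_degree_monomial hw LamL NSI.
split.
- by rewrite irrelevant_idealE; apply: radical_irrelevant r_deg.
- exact: quotient_nonzero.
- exact: quotient_finite_dimensional r_deg.
- exact: quotient_local r_deg.
- exact: quotient_finite_length r_deg.
Qed.
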